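(* Let $q$ be a prime power, $\gamma$ a primitive element of $\mathbb{F}_q$, $\ell$ a positive divisor of $q-1$, $s=(q-1)/\ell$, $r$ a positive integer and $t=\gcd(r,s)$. Choose $a_0,\dots,a_{\ell-1}$ independently and uniformly at random from $\mathbb{F}_q$, let $f=f^{r}_{a_0,\ldots,a_{\ell-1}}$ be the $r$-th order cyclotomic mapping of index $\ell$, and let $X_{t\ell}=|f(\mathbb{F}_q)|$ be the size of its value set. Then for $0\le k\le t\ell$, $${\mathbb P}(X_{t\ell}=1+ks/t) = {t\ell\choose k} \sum_{j=0}^{k} (-1)^{k -j} {k\choose j}\left(\frac{1}{q} + \frac{sj}{tq}\right)^{\ell}.$$
   Context: For $\ell\mid q-1$, let $C_0$ be the subgroup of $\mathbb{F}_q^*$ of nonzero $\ell$-th powers and $C_i=\gamma^iC_0$, $0\le i\le \ell-1$. The $r$-th order cyclotomic mapping $f^r_{a_0,\dots,a_{\ell-1}}$ of index $\ell$ is the map $\mathbb{F}_q\to\mathbb{F}_q$ with $0\mapsto0$ and $x\mapsto a_ix^r$ for $x\in C_i$. *)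

(* Defs.v *)
From HB Require Import structures.
From mathcomp Require Import all_boot all_order all_algebra finfield.
From mathcomp Require Import all_classical all_reals all_analysis.

Set Implicit Arguments.
Unset Strict Implicit.
Unset Printing Implicit Defensive.

Import Order.TTheory GRing.Theory Num.Theory.
Local Open Scope ring_scope.

Section Cyclotomic.
Variables (F : finFieldType) (l : nat) (gamma : F).

Definition cyclotomic_coset0 : {set F} :=
  (fun x : F => x ^+ l) @: [pred x : F | x != 0].

Definition cyclotomic_coset (i : nat) : {set F} :=
  (fun y : F => gamma ^+ i * y) @: cyclotomic_coset0.

(* Under the hypotheses below the cosets C_i, i < l, partition F^*, so the
   picked index is the unique i with x \in C_i; 0 lies in no coset. *)
Definition cyclotomic_mapping (r : nat) (a : 'I_l -> F) (x : F) : F :=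
  if [pick i : 'I_l | x \in cyclotomic_coset i] is Some i
  then a i * x ^+ r else 0.

Hypothesis gamma_prim : #|F|.-1.-primitive_root gamma.
Hypothesis l_dvd : (l %| #|F|.-1)%N.

Let gamma_neq0 : gamma != 0.
Proof.
apply/eqP => g0; have := prim_expr_order gamma_prim; rewrite g0 expr0n.
rewrite gtn_eqF ?(prim_order_gt0 gamma_prim) //= => /esym/eqP.
by rewrite oner_eq0.
Qed.

Let prim_expP (x : F) : x != 0 -> exists n, x = gamma ^+ n.
Proof.
move=> xn0; have /(prim_rootP gamma_prim)[n ->] : x ^+ #|F|.-1 = 1.
  apply: (mulfI xn0); rewrite -exprS (ltn_predK (finNzRing_gt1 F)).
  by rewrite expf_card mulr1.
by exists n.
Qed.

Lemma cyclotomic_coset_cover (x : F) :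
  x != 0 -> exists i : 'I_l, x \in cyclotomic_coset i.
Proof.
have l_gt0 : (0 < l)%N by apply: dvdn_gt0 (prim_order_gt0 gamma_prim) l_dvd.
move=> /prim_expP[n ->]; exists (Ordinal (ltn_pmod n l_gt0)).
apply/imsetP; exists (gamma ^+ (n %/ l) ^+ l) => /=.
  by apply/imsetP; exists (gamma ^+ (n %/ l)) => //; rewrite inE expf_neq0.
by rewrite -exprM -exprD addnC -divn_eq.
Qed.

Lemma cyclotomic_mapping0 r (a : 'I_l -> F) : cyclotomic_mapping r a 0 = 0.
Proof.
rewrite /cyclotomic_mapping; case: pickP => // i /imsetP[y /imsetP[x]].
rewrite inE => xn0 -> /esym/eqP; rewrite mulf_eq0 !expf_eq0.
by rewrite (negbTE gamma_neq0) (negbTE xn0) !andbF.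
Qed.

Lemma cyclotomic_mappingE r (a : 'I_l -> F) (i : 'I_l) (x : F) :
  x \in cyclotomic_coset i -> cyclotomic_mapping r a x = a i * x ^+ r.
Proof.
move=> xi; rewrite /cyclotomic_mapping.
case: pickP => [j xj|/(_ i)]; last by rewrite xi.
suff -> : j = i by [].
have key (m : 'I_l) z :
    z \in cyclotomic_coset m -> exists2 n, z = gamma ^+ n & (n %% l = m)%N.
  move=> /imsetP[y /imsetP[w]]; rewrite inE => /prim_expP[n ->] -> ->.
  exists (m + n * l)%N; first by rewrite exprD exprM.
  by rewrite addnC modnMDl modn_small.
have [n e1 n1] := key _ _ xi; have [m e2 m1] := key _ _ xj.
have /eqP := etrans (esym e1) e2.
rewrite (eq_prim_root_expr gamma_prim) => /eqP e.
by apply/val_inj; rewrite /= -n1 -m1 -(modn_dvdm n l_dvd) -(modn_dvdm m l_dvd) e.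
Qed.

End Cyclotomic.

Local Open Scope classical_set_scope.

Section RandomVariables.
Variables (d : measure_display) (T : measurableType d) (R : realType).
Variable P : probability T R.

(* Measurability of X when S carries the sigma-algebra of all subsets. *)
Definition discretely_measurable (S : Type) (X : T -> S) : Prop :=
  forall B : set S, measurable (X @^-1` B).

Definition uniformly_distributed (S : finType) (X : T -> S) : Prop :=
  forall c : S, P (X @^-1` [set c]) = ((#|S|%:R : R)^-1)%:E.

Definition mutually_independent (I : finType) (S : Type) (X : I -> T -> S)
    : Prop :=
  forall (J : {set I}) (B : I -> set S),
    P (\bigcap_(i in [set` J]) (X i @^-1` B i)) =
    (\prod_(i in J) P (X i @^-1` B i))%E.

End RandomVariables.

Arguments discretely_measurable {d T S} X.

(* Main.v *)
(* Put t = gcd(r, s), m = s / t. For a_i != 0 the map sends C_i onto the coset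
   a_i gamma^(i r) C_0^r, and C_0^r is the subgroup of order m and index t l
   of F^*. So the number of values is 1 + m N, where N is the number of distinct
   cosets hit by l independent throws, the i-th of which hits nothing with
   probability 1/q and each coset with probability m/q. All throws stay inside
   a given set of j cosets with probability ((1 + m j)/q)^l, and Moebius
   inversion over sets of cosets yields the law of N. *)
Require Import Defs.
From HB Require Import structures.
From mathcomp Require Import all_boot all_order all_algebra finfield.
From mathcomp Require Import all_classical all_reals all_analysis.
From mathcomp Require Import ring.

Set Implicit Arguments.
Unset Strict Implicit.
Unset Printing Implicit Defensive.

Import Order.TTheory GRing.Theory Num.Theory.
Local Open Scope classical_set_scope.
Local Open Scope ring_scope.

(** * Möbius inversion over the subsets of a finite set *)

Lemma sum_subset_card (C : finType) (M : nmodType) (A : {set C})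
    (g : nat -> M) :
  \sum_(J : {set C} | J \subset A) g #|J| =
  \sum_(j < #|A|.+1) g j *+ 'C(#|A|, j).
Proof.
(* [inord] never takes its default value here, since [J \subset A] bounds [#|J|] by [#|A|]. *)
rewrite (partition_big (fun J : {set C} => inord #|J| : 'I_#|A|.+1) predT) //=.
apply: eq_bigr => j _; rewrite -cards_draws -sumr_const.
apply: congr_big => // [J|J].
  rewrite inE; case: (boolP (J \subset A)) => //= /subset_leq_card JA.
  by rewrite -val_eqE /= inordK.
by case/andP=> /subset_leq_card JA /eqP <-; rewrite inordK.
Qed.

Lemma sum_subset_sign (C : finType) (R : pzRingType) (A : {set C}) :
  \sum_(J : {set C} | J \subset A) (-1) ^+ #|J| = (A == finset.set0)%:R :> R.
Proof.
(* Grouped by cardinality, the sum is the binomial expansion of [(1 - 1) ^+ #|A|]. *)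
rewrite sum_subset_card -cards_eq0 -expr0n -[X in X ^+ _](subrr 1).
rewrite exprDn_comm; last exact: commrN1.
by apply: eq_bigr => i _; rewrite expr1n mul1r.
Qed.

Lemma sum_subset_setD (C : finType) (M : nmodType) (A : {set C})
    (G : {set C} -> M) :
  \sum_(J : {set C} | J \subset A) G J =
  \sum_(J : {set C} | J \subset A) G (A :\: J).
Proof.
rewrite (reindex_onto (fun J => A :\: J) (fun J => A :\: J)) /=.
  apply: eq_bigl => J; rewrite finset.subsetDl /= finset.setDDr finset.setDv finset.set0U.
  by apply/eqP/finset.setIidPr.
by move=> J JA; rewrite finset.setDDr finset.setDv finset.set0U; apply/finset.setIidPr.
Qed.

(** After replacing [J] by its complement in [K], the condition says that [H \subset K] and that [J]
    lies in [K :\: H], with sign [(-1) ^+ #|J|]. The signs cancel unless [K :\: H] is empty. *)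
Lemma eq_set_moebius (C : finType) (R : pzRingType) (H K : {set C}) :
  (H == K)%:R = \sum_(J : {set C} | J \subset K)
    (-1) ^+ (#|K| - #|J|) * (H \subset J)%:R :> R.
Proof.
rewrite sum_subset_setD.
have E (J : {set C}) : J \subset K ->
    (-1) ^+ (#|K| - #|K :\: J|) * (H \subset K :\: J)%:R =
    (if (H \subset K) && (J \subset ~: H) then (-1) ^+ #|J| else 0) :> R.
  move=> JK; rewrite cardsDS // subKn ?subset_leq_card //.
  rewrite finset.subsetD disjoint_sym finset.disjoints_subset.
  by case: (_ && _); rewrite ?mulr1 ?mulr0.
rewrite (eq_bigr _ E) -big_mkcondr /=.
case: (boolP (H \subset K)) => HK; last first.
  rewrite big_pred0 => [|J]; last by rewrite andbF.
  by case: eqP HK => // ->; rewrite subxx.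
rewrite -(_ : (K :\: H == finset.set0) = (H == K)); last first.
  by rewrite finset.setD_eq0 finset.eqEsubset HK.
rewrite -sum_subset_sign; apply: eq_bigl => J.
by rewrite finset.setDE finset.subsetI.
Qed.

(** Split the event [#|H v| == k] over the [k]-subsets [K] of [U] that [H v] may equal, and invert
    each indicator. The count for [J] depends only on [#|J|], so every [K] contributes the same
    amount, which produces the factor ['C(#|U|, k)]. *)
Lemma card_eq_inclusion_exclusion (V C : finType) (R : pzRingType)
    (U : {set C}) (H : V -> {set C}) (g : nat -> nat) (k : nat) :
  (forall v, H v \subset U) ->
  (forall J : {set C}, J \subset U -> #|[set v | H v \subset J]%SET| = g #|J|) ->
  #|[set v | #|H v| == k]%SET|%:R =
  'C(#|U|, k)%:R * \sum_(0 <= j < k.+1)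
    (-1) ^+ (k - j) * 'C(k, j)%:R * (g j)%:R :> R.
Proof.
move=> HU Hg; rewrite -cards_draws -sum1_card natr_sum big_mkcond /=.
transitivity (\sum_(v : V)
    \sum_(K in [set B : {set C} | (B \subset U) && (#|B| == k)]%SET)
    (H v == K)%:R : R).
  apply: eq_bigr => v _; rewrite inE.
  case: (boolP (#|H v| == k)) => Hk.
    rewrite (bigD1 (H v)) /= ?inE ?HU ?Hk // eqxx big1 ?addr0 // => K.
    by case/andP=> _; rewrite eq_sym => /negbTE->.
  rewrite big1 // => K; rewrite inE => /andP[_ /eqP Kk].
  by have [HK|//] := eqVneq (H v) K; rewrite HK Kk eqxx in Hk.
rewrite exchange_big /= mulr_natl -sumr_const; apply: eq_bigr => K.
rewrite inE => /andP[KU /eqP Kk].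
under eq_bigr do rewrite eq_set_moebius.
rewrite exchange_big /=.
transitivity (\sum_(J : {set C} | J \subset K) (-1) ^+ (#|K| - #|J|) * (g #|J|)%:R : R).
  apply: eq_bigr => J JK; rewrite -big_distrr /= -natr_sum.
  congr (_ * _%:R); rewrite -Hg; last exact: fintype.subset_trans JK KU.
  by rewrite -sum1_card [RHS]big_mkcond /=; apply: eq_bigr => v _; rewrite inE; case: ifP.
rewrite (sum_subset_card K (fun j => (-1) ^+ (#|K| - j) * (g j)%:R)) Kk.
rewrite big_mkord; apply: eq_bigr => j _.
by rewrite -[LHS]mulr_natr -!mulrA -!natrM mulnC.
Qed.

(** * Fibres and images of power maps on the multiplicative group *)

Lemma prim_root_neq0 (R : nzRingType) (n : nat) (z : R) :
  n.-primitive_root z -> z != 0.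
Proof.
move=> zP; apply/eqP => z0; have := prim_expr_order zP.
rewrite z0 expr0n eqn0Ngt (prim_order_gt0 zP) => /eqP.
by rewrite eq_sym oner_eq0.
Qed.

Lemma card_prim_unity_roots (F : finFieldType) (m : nat) (z : F) :
  m.-primitive_root z -> #|[set x : F | x ^+ m == 1]%SET| = m.
Proof.
move=> zP; rewrite -[RHS]card_ord -(card_imset predT (f := fun i : 'I_m => z ^+ i)).
  apply: eq_card => x; rewrite inE; apply/eqP/imsetP => [|[i _ ->]].
    by move=> /(prim_rootP zP)[i ->]; exists i.
  by rewrite exprAC (prim_expr_order zP) expr1n.
move=> i j /eqP; rewrite (eq_prim_root_expr zP) !modn_small // => /eqP.
exact: val_inj.
Qed.

(** The fibre of [x ^+ m] over a point of the image is a translate of the group of [m]-th roots of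
    unity, which has exactly [m] elements because [m] divides [#|F|.-1]. *)
Lemma card_preim_expr (F : finFieldType) (gamma : F) (m : nat) (J : {set F}) :
  #|F|.-1.-primitive_root gamma -> (m %| #|F|.-1)%N ->
  J \subset [set x ^+ m | x in [pred x : F | x != 0%R]]%SET ->
  #|[set x : F | (x != 0%R) && (x ^+ m \in J)]%SET| = (m * #|J|)%N.
Proof.
move=> gP mF JU; rewrite -sum1_card.
rewrite (partition_big (fun x : F => x ^+ m) (fun y => y \in J)) => [|x]; last first.
  by rewrite inE => /andP[].
rewrite mulnC -sum_nat_const; apply: eq_bigr => y yJ.
have /imsetP[x0] := fintype.subsetP JU _ yJ; rewrite inE => x0N yE.
rewrite sum1dep_card -[RHS](card_prim_unity_roots (dvdn_prim_root gP mF)).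
rewrite -[RHS](card_imset _ (mulfI x0N)); apply: eq_card => x; rewrite !inE.
apply/andP/imsetP => [[_ /eqP xE]|[w]].
  exists (x / x0); last by rewrite mulrC divfK.
  by rewrite inE expr_div_n xE yE divff // expf_neq0.
rewrite inE => /eqP wm ->; rewrite exprMn wm mulr1 -yE eqxx yJ mulf_neq0 //.
apply/eqP => w0; move: wm; rewrite w0 expr0n eqn0Ngt.
rewrite (dvdn_gt0 (prim_order_gt0 gP) mF) /= => /eqP.
by rewrite eq_sym oner_eq0.
Qed.

Lemma card_expr_image (F : finFieldType) (gamma : F) (m : nat) :
  #|F|.-1.-primitive_root gamma -> (m %| #|F|.-1)%N ->
  (m * #|[set (x ^+ m)%R | x in [pred x : F | x != 0%R]]%SET|)%N = #|F|.-1.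
Proof.
move=> gP mF; rewrite -(card_preim_expr gP mF (subxx _)) -(cardC1 (0 : F)).
apply: eq_card => x; rewrite inE !unfold_in; case: (eqVneq x 0) => //= xN.
by apply/imsetP; exists x.
Qed.

(** * The value set of a cyclotomic mapping, and counting coefficient vectors *)

(* With [m = s / gcd r s], two nonzero elements lie in the same coset of
   [C_0^r] iff their [m]-th powers agree, so [hit_cosets] encodes the cosets
   [a_i gamma^(i r) C_0^r], [a_i != 0], which make up the nonzero values. *)
Definition hit_cosets (F : finFieldType) (gamma : F) (l r m : nat)
    (a : 'I_l -> F) : {set F} :=
  [set (a i * gamma ^+ (i * r)) ^+ m | i in [pred i | a i != 0]]%SET.

Lemma cyclotomic_imageE (F : finFieldType) (gamma : F) (l r s : nat)
    (a : 'I_l -> F) :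
  #|F|.-1.-primitive_root gamma -> #|F|.-1 = (l * s)%N -> (0 < r)%N ->
  (cyclotomic_mapping gamma r a @: F)%SET =
  (0 |: [set y : F | (y != 0) &&
          (y ^+ (s %/ gcdn r s) \in hit_cosets gamma r (s %/ gcdn r s) a)])%SET.
Proof.
move=> gP qE r_gt0; set t := gcdn r s; set m := (s %/ t)%N.
have lF : (l %| #|F|.-1)%N by rewrite qE dvdn_mulr.
have g0 := prim_root_neq0 gP.
have tm : (t * m = s)%N by rewrite mulnC divnK ?dvdn_gcdr.
have s_gt0 : (0 < s)%N by have := prim_order_gt0 gP; rewrite qE muln_gt0 => /andP[].
have expF1 (x : F) : x != 0 -> x ^+ (l * s) = 1.
  move=> xN; apply: (mulfI xN).
  by rewrite -exprS -qE (ltn_predK (finNzRing_gt1 F)) expf_card mulr1.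
apply/setP => y; rewrite finset.in_setU1 inE; apply/imsetP/idP => [[x _ ->]|].
  have [->|xN] := eqVneq x 0; first by rewrite (cyclotomic_mapping0 gP) eqxx.
  have [i xi] := cyclotomic_coset_cover gP lF xN.
  rewrite (cyclotomic_mappingE gP lF _ _ xi) mulf_eq0 (negbTE (expf_neq0 r xN)) orbF.
  case: eqVneq => //= aN; apply/imsetP; exists i => //.
  case/imsetP: xi => z /imsetP[w]; rewrite inE => wN -> ->.
  rewrite !exprMn -!exprM; congr (_ * _).
  (* As [t] divides [r], this exponent is a multiple of [l * s], so the [l]-th power factor of [x]
     disappears from the [m]-th power of the value. *)
  have -> : (l * (r * m) = (l * s) * (r %/ t))%N.
    rewrite -{1}(divnK (dvdn_gcdl r s)) -/t -tm; ring.
  by rewrite [w ^+ _]exprM expF1 // expr1n mulr1 mulnA.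
have [->|yN] := eqVneq y 0 => [_|].
  by exists 0; rewrite ?(cyclotomic_mapping0 gP).
move=> /= /imsetP[i]; rewrite inE => aN yE.
have bN : a i * gamma ^+ (i * r) != 0 by rewrite mulf_neq0 // expf_neq0.
pose e := y / (a i * gamma ^+ (i * r)).
have eN : e ^+ m = 1 by rewrite expr_div_n yE divff // expf_neq0.
(* The [m]-th roots of unity are the powers of [gamma ^+ (#|F|.-1 %/ m)], and this exponent is
   [l * t]. *)
have [n en] : {n : nat | e = gamma ^+ (l * t * n)}.
  have mF : (m %| #|F|.-1)%N by rewrite qE -tm !dvdn_mull.
  have /(prim_rootP (dvdn_prim_root gP mF))[n ->] := eN.
  exists n; rewrite -exprM; congr (_ ^+ (_ * _)).
  by rewrite qE -tm mulnA mulnK //; rewrite -tm muln_gt0 in s_gt0; case/andP: s_gt0.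
(* Bezout gives [km * r = kn * s + t]. Modulo the order [l * s] of [gamma], the exponent [l * t * n]
   is then [r] times [l * km * n], so [e] is the [r]-th power of an element of [C_0]. *)
have [km kn kE _] := egcdnP s r_gt0.
pose x := gamma ^+ i * (gamma ^+ (km * n)) ^+ l.
have xi : x \in cyclotomic_coset l gamma i.
  apply/imsetP; exists ((gamma ^+ (km * n)) ^+ l) => //.
  by apply/imsetP; exists (gamma ^+ (km * n)); rewrite // inE expf_neq0.
exists x => //; rewrite (cyclotomic_mappingE gP lF _ _ xi).
transitivity (e * (a i * gamma ^+ (i * r))); first by rewrite divfK.
rewrite en mulrC -mulrA; congr (_ * _); rewrite exprMn -!exprM; congr (_ * _).
have -> : (km * n * l * r = (l * s) * (kn * n) + l * t * n)%N.
  transitivity ((km * r) * (n * l))%N; first by ring.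
  rewrite kE -/t; ring.
by rewrite exprD [gamma ^+ (l * s * _)]exprM expF1 // expr1n mul1r.
Qed.

(** The inclusion constrains each coordinate separately: [v i] is either 0, which hits nothing, or
    one of the [m * #|J|] elements whose multiple by [gamma ^+ (i * r)] has its [m]-th power in [J].
    The vectors therefore form a product of [l] sets of equal size. *)
Lemma card_hit_cosets_sub (F : finFieldType) (gamma : F) (l r m : nat)
    (J : {set F}) :
  #|F|.-1.-primitive_root gamma -> (m %| #|F|.-1)%N ->
  J \subset [set x ^+ m | x in [pred x : F | x != 0]]%SET ->
  #|[set v : {ffun 'I_l -> F} | hit_cosets gamma r m v \subset J]%SET| =
  ((1 + m * #|J|) ^ l)%N.
Proof.
move=> gP mF JU.
have g0 := prim_root_neq0 gP.
pose A (i : 'I_l) : {pred F} :=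
  [pred c | (c == 0) || ((c * gamma ^+ (i * r)) ^+ m \in J)].
have cardA i : #|A i| = (1 + m * #|J|)%N.
  have bN : gamma ^+ (i * r) != 0 by rewrite expf_neq0.
  rewrite (cardD1 0) inE eqxx -(card_preim_expr gP mF JU) /=; congr (_ + _)%N.
  rewrite -(card_imset _ (mulIf bN)); apply: eq_card => y; rewrite inE.
  apply/imsetP/andP => [[c]|[yN yJ]].
    rewrite !inE => /andP[cN]; rewrite (negbTE cN) /= => cJ ->.
    by rewrite mulf_neq0.
  exists (y / gamma ^+ (i * r)); last by rewrite divfK.
  by rewrite !inE divfK // yJ orbT andbT mulf_neq0 // invr_eq0.
transitivity #|(family A : simpl_pred {ffun 'I_l -> F})|.
  apply: eq_card => v; rewrite inE; apply/fintype.subsetP/familyP => [vJ i|vA y].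
    rewrite inE; case: eqVneq => //= vN.
    by apply: vJ; apply/imsetP; exists i.
  case/imsetP=> i; rewrite inE => vN ->.
  by have := vA i; rewrite inE (negbTE vN).
rewrite card_family -[X in (_ ^ X)%N](size_enum_ord l) /image_mem.
by elim: (enum 'I_l) => //= i e ->; rewrite cardA expnS.
Qed.

Lemma card_cyclotomic_image (F : finFieldType) (gamma : F) (l r s k : nat) :
  let t := gcdn r s in
  let m := (s %/ t)%N in
  #|F|.-1.-primitive_root gamma -> #|F|.-1 = (l * s)%N -> (0 < r)%N ->
  forall R : comPzRingType,
  #|[set v : {ffun 'I_l -> F} |
      #|cyclotomic_mapping gamma r v @: F| == (1 + k * m)%N]%SET|%:R =
  'C(t * l, k)%:R * \sum_(0 <= j < k.+1)
    (-1) ^+ (k - j) * 'C(k, j)%:R * (1 + m%:R * j%:R) ^+ l :> R.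
Proof.
move=> t m gP qE r_gt0 R.
have tm : (t * m = s)%N by rewrite mulnC divnK ?dvdn_gcdr.
have mF : (m %| #|F|.-1)%N by rewrite qE -tm !dvdn_mull.
have m_gt0 : (0 < m)%N := dvdn_gt0 (prim_order_gt0 gP) mF.
set U := [set x ^+ m | x in [pred x : F | x != 0]]%SET.
have HU (v : 'I_l -> F) : hit_cosets gamma r m v \subset U.
  apply/fintype.subsetP => y /imsetP[i]; rewrite inE => vN ->; apply/imsetP.
  have g0 := prim_root_neq0 gP.
  by exists (v i * gamma ^+ (i * r)); rewrite // inE mulf_neq0 // expf_neq0.
have UE : #|U| = (t * l)%N.
  apply/eqP; rewrite -(eqn_pmul2l m_gt0) (card_expr_image gP mF) qE -tm.
  by apply/eqP; ring.
have -> : #|[set v : {ffun 'I_l -> F} |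
      #|cyclotomic_mapping gamma r v @: F| == (1 + k * m)%N]%SET| =
    #|[set v : {ffun 'I_l -> F} | #|hit_cosets gamma r m v| == k]%SET|.
  apply: eq_card => v; rewrite !inE (cyclotomic_imageE _ gP qE r_gt0).
  (* The value 0 is always attained, and each hit coset adds [m] nonzero values. *)
  rewrite cardsU1 inE eqxx /= -/t -/m (card_preim_expr gP mF (HU v)).
  by rewrite eqn_add2l [RHS]eq_sym mulnC eqn_pmul2r // eq_sym.
rewrite (card_eq_inclusion_exclusion R (g := fun j => (1 + m * j) ^ l)%N k
  (fun v : {ffun 'I_l -> F} => HU v)).
  rewrite UE; congr (_ * _); apply: eq_bigr => j _.
  by rewrite natrX natrD natrM.
by move=> J JU; apply: card_hit_cosets_sub.
Qed.

(** * From counts to probabilities *)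

Lemma probability_finite_preimage (d : measure_display) (T : measurableType d)
    (R : realType) (P : probability T R) (S : finType) (X : T -> S)
    (B : {set S}) :
  (forall c, measurable (X @^-1` [set c])) ->
  P [set w | X w \in B] = (\sum_(c in B) P (X @^-1` [set c]))%E.
Proof.
move=> mX; have -> : [set w | X w \in B] =
    \bigcup_(c in [set` B]) (X @^-1` [set c]).
  by apply/seteqP; split=> [w wB|w [c /[swap] /= <-]] //; exists (X w).
rewrite measure_fin_bigcup //; last by move=> c c' _ _ [w [<- <-]].
apply/esym/bigfs => [|c _]; first exact: index_enum_uniq.
by rewrite mem_index_enum.
Qed.

(** Independence over the full index set, applied to singletons, makes the joint vector uniform on
    [{ffun I -> S}]. *)
Lemma uniform_family_preimage (d : measure_display) (T : measurableType d)
    (R : realType) (P : probability T R) (I S : finType) (a : I -> T -> S)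
    (v : {ffun I -> S}) :
  (forall i, uniformly_distributed P (a i)) -> mutually_independent P a ->
  P ((fun w => [ffun i => a i w]) @^-1` [set v]) = ((#|S|%:R ^- #|I| : R))%:E.
Proof.
move=> aU aI; have := aI [set: I]%SET (fun i => [set v i]).
rewrite (_ : \bigcap_(i in _) _ =
    (fun w => [ffun i => a i w]) @^-1` [set v]) => [->|]; last first.
  apply/seteqP; split=> w /= => [H|<- i _ /=]; last by rewrite ffunE.
  by apply/ffunP => i; rewrite ffunE; apply: H; rewrite /= inE.
under eq_bigr do rewrite aU.
by rewrite prodEFin prodr_const cardsT exprVn.
Qed.

Theorem theorem4p2 (F : finFieldType) (gamma : F) (l r : nat)
    (d : measure_display) (T : measurableType d) (R : realType)
    (P : probability T R) (a : 'I_l -> T -> F) (k : nat) :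
  let q := #|F| in
  let s := (q.-1 %/ l)%N in
  let t := gcdn r s in
  q.-1.-primitive_root gamma ->
  (0 < l)%N -> (l %| q.-1)%N -> (0 < r)%N ->
  (forall i, discretely_measurable (a i)) ->
  (forall i, uniformly_distributed P (a i)) ->
  mutually_independent P a ->
  (k <= t * l)%N ->
  let X := fun w : T =>
    #|cyclotomic_mapping gamma r (fun i => a i w) @: F| in
  P [set w | X w = (1 + k * s %/ t)%N] =
  ('C(t * l, k)%:R *
   \sum_(0 <= j < k.+1)
     (-1) ^+ (k - j) * 'C(k, j)%:R *
     (1 / q%:R + s%:R * j%:R / (t%:R * q%:R)) ^+ l)%:E.
Proof.
move=> q s t gP l_gt0 lF r_gt0 mA aU aI k_le /=.
set m := (s %/ t)%N.
have qE : #|F|.-1 = (l * s)%N by rewrite mulnC divnK.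
have tm : (t * m = s)%N by rewrite mulnC divnK ?dvdn_gcdr.
have s_gt0 : (0 < s)%N.
  by have := prim_order_gt0 gP; rewrite /q qE muln_gt0 => /andP[].
have t_neq0 : t%:R != 0 :> R.
  by rewrite pnatr_eq0 -lt0n; move: s_gt0; rewrite -tm muln_gt0 => /andP[].
have q_neq0 : q%:R != 0 :> R.
  by rewrite pnatr_eq0 -lt0n (leq_trans (prim_order_gt0 gP)) ?leq_pred.
have -> : (k * s %/ t = k * m)%N by rewrite /m muln_divA ?dvdn_gcdr.
(* As a random element of a finite type, the coefficient vector splits the event into finitely many
   fibres of equal probability. *)
pose A w := [ffun i => a i w].
pose B := [set v : {ffun 'I_l -> F} |
  #|cyclotomic_mapping gamma r v @: F| == (1 + k * m)%N]%SET.
have -> : [set w | #|cyclotomic_mapping gamma r (fun i => a i w) @: F| =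
    (1 + k * m)%N] = [set w | A w \in B].
  have AE w : A w = (fun i => a i w) :> (_ -> _).
    by apply/funext => i; rewrite ffunE.
  by apply/seteqP; split=> w /=; rewrite inE AE => /eqP.
rewrite probability_finite_preimage; last first.
  move=> v; rewrite (_ : _ @^-1` _ = \bigcap_(i in [set: 'I_l]) (a i @^-1` [set v i])).
    by apply: fin_bigcap_measurable => [|i _]; [exact: finite_finset|exact: mA].
  apply/seteqP; split=> w /= => [<- i _ /=|H]; first by rewrite ffunE.
  by apply/ffunP => i; rewrite ffunE; apply: H.
rewrite (eq_bigr _ (fun v _ => uniform_family_preimage v aU aI)).
rewrite sumEFin; congr _%:E.
rewrite sumr_const card_ord -[LHS]mulr_natl (card_cyclotomic_image k gP qE r_gt0).
rewrite -mulrA mulr_suml; congr (_ * _); apply: eq_bigr => j _.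
(* The weight [q ^- l] of one vector is absorbed into the [l]-th power, and [s = t * m] turns
   [m / q] into [s / (t * q)]. *)
rewrite -[LHS]mulrA -exprVn -exprMn; congr (_ * _ ^+ _).
by rewrite -/q -/t -/m -[in RHS]tm natrM; field; rewrite t_neq0 q_neq0.
Qed.
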